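(* Let $A$ be a noetherian commutative $\mathbb N$-graded ring, $\mathfrak m=A_+$, and $I=(a_1,\dots,a_n)$ an ideal of $A$ such that $\mathrm{depth}_{\mathfrak m}(A)>\mathrm{depth}_I(A)=n-1$. Let $Z_1\subset A^n$ be the module of syzygies $\{(x_1,\dots,x_n):\sum x_ia_i=0\}$ and $B_1\subset Z_1$ the submodule of Koszul syzygies (generated by $a_je_i-a_ie_j$). Then the following are equivalent: (a) $B_1=Z_1\cap I\cdot A^n$; (b) $B_1=Z_1\cap\mathrm{TF}_{\mathfrak m}(I)\cdot A^n$; (c) $I$ is syzygetic.
   Context: $\mathrm{TF}_{\mathfrak m}(I)=\{a\in A:\exists m,\ a\mathfrak m^m\subset I\}$ (the saturation of $I$). $I$ is syzygetic if the kernel $\delta(I)$ of the canonical surjection $\mathrm{Sym}^2_A(I)\to I^2$ is zero. $\mathrm{depth}_{\mathfrak a}(A)$ is the grade of $\mathfrak a$. *)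

(* Defs.v *)
From HB Require Import structures.
From mathcomp Require Import all_boot all_order all_algebra.
Set Implicit Arguments. Unset Strict Implicit. Unset Printing Implicit Defensive.
Import Order.TTheory GRing.Theory.
Local Open Scope ring_scope.

Section Defs.
Variable R : comNzRingType.

Definition span (S : R -> Prop) : R -> Prop :=
  fun x => exists (k : nat) (c y : 'I_k -> R),
    (forall i, S (y i)) /\ x = \sum_(i < k) c i * y i.

Definition is_ideal (J : R -> Prop) : Prop :=
  J 0 /\ (forall x y, J x -> J y -> J (x + y)) /\ (forall r x, J x -> J (r * x)).

Definition noetherian : Prop :=
  forall J, is_ideal J -> exists s : seq R, forall x, J x <-> span (fun y => y \in s) x.

Definition is_grading (G : nat -> R -> Prop) : Prop :=
  [/\ (forall d, G d 0 /\ forall x y, G d x -> G d y -> G d (x - y)),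
      G 0%N 1,
      (forall d e x y, G d x -> G e y -> G (d + e)%N (x * y)),
      (forall x, exists (N : nat) (f : nat -> R),
          (forall d, G d (f d)) /\ x = \sum_(d < N) f d) &
      (forall (N : nat) (f : nat -> R), (forall d, G d (f d)) ->
          \sum_(d < N) f d = 0 -> forall d, (d < N)%N -> f d = 0)].

Definition irrelevant (G : nat -> R -> Prop) : R -> Prop :=
  span (fun y => exists d, (0 < d)%N /\ G d y).

Definition ideal_mul (I J : R -> Prop) : R -> Prop :=
  span (fun z => exists x y, [/\ I x, J y & z = x * y]).

Fixpoint ideal_pow (I : R -> Prop) (k : nat) : R -> Prop :=
  match k with
  | 0%N => fun _ => True
  | k'.+1 => ideal_mul (ideal_pow I k') I
  end.

Definition TF (m I : R -> Prop) : R -> Prop :=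
  fun a => exists k : nat, forall y, ideal_pow m k y -> I (a * y).

Definition regular_seq (s : seq R) : Prop :=
  ~ span (fun y => y \in s) 1 /\
  forall i, (i < size s)%N -> forall y,
    span (fun z => z \in take i s) (nth 0 s i * y) ->
    span (fun z => z \in take i s) y.

(* grade(J) >= k  (grade of the unit ideal is +oo by convention). *)
Definition grade_ge (J : R -> Prop) (k : nat) : Prop :=
  J 1 \/ exists s : seq R, [/\ size s = k, (forall x, x \in s -> J x) & regular_seq s].

Definition ideal_of (n : nat) (a : 'I_n -> R) : R -> Prop :=
  span (fun y => exists i, y = a i).

Definition Z1 (n : nat) (a : 'I_n -> R) (x : 'I_n -> R) : Prop :=
  \sum_(i < n) x i * a i = 0.

(* B_1 : submodule generated by the Koszul syzygies a_j e_i - a_i e_j. *)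
Definition B1 (n : nat) (a : 'I_n -> R) (x : 'I_n -> R) : Prop :=
  exists c : 'I_n -> 'I_n -> R,
    forall k, x k = \sum_(j < n) c k j * a j - \sum_(i < n) c i k * a i.

Definition ext_mod (n : nat) (J : R -> Prop) (x : 'I_n -> R) : Prop :=
  forall k, J (x k).

(* Sym^2_A(I) is presented as the free A-module on the symbols [x,y], (x,y) in I x I,
   modulo the submodule generated by the relations below. *)
Inductive sym2_gen : Type :=
  | S2Add of R & R & R      (* [x+x',y] - [x,y] - [x',y] *)
  | S2Scal of R & R & R     (* [r x, y] - r [x,y]          *)
  | S2Sym of R & R.         (* [x,y] - [y,x]               *)

Definition sym2_gen_in (I : R -> Prop) (g : sym2_gen) : Prop :=
  match g with
  | S2Add x x' y => [/\ I x, I x' & I y]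
  | S2Scal _ x y => I x /\ I y
  | S2Sym x y => I x /\ I y
  end.

Definition ind (b : bool) : R := if b then 1 else 0.

(* coefficient of the basis symbol [p.1, p.2] in the relation g *)
Definition sym2_gen_coef (g : sym2_gen) (p : R * R) : R :=
  match g with
  | S2Add x x' y => ind ((x + x', y) == p) - ind ((x, y) == p) - ind ((x', y) == p)
  | S2Scal r x y => ind ((r * x, y) == p) - r * ind ((x, y) == p)
  | S2Sym x y => ind ((x, y) == p) - ind ((y, x) == p)
  end.

(* coefficient of [p.1,p.2] in the formal sum \sum_i r_i [x_i, y_i] *)
Definition formal_coef (k : nat) (r x y : 'I_k -> R) (p : R * R) : R :=
  \sum_(i < k) r i * ind ((x i, y i) == p).

(* I is syzygetic: the kernel delta(I) of Sym^2_A(I) -> I^2, [x,y] |-> xy, is zero,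
   i.e. every formal sum mapping to 0 in I^2 lies in the relation submodule. *)
Definition syzygetic (I : R -> Prop) : Prop :=
  forall (k : nat) (r x y : 'I_k -> R),
    (forall i, I (x i) /\ I (y i)) ->
    \sum_(i < k) r i * (x i * y i) = 0 ->
    exists (l : nat) (c : 'I_l -> R) (g : 'I_l -> sym2_gen),
      (forall j, sym2_gen_in I (g j)) /\
      forall p, formal_coef r x y p = \sum_(j < l) c j * sym2_gen_coef (g j) p.

End Defs.

(* Main.v *)
Require Import Defs.
From HB Require Import structures.
From mathcomp Require Import all_boot all_order all_algebra.
From mathcomp Require Import ring.
Import GRing.Theory Defs.
Local Open Scope ring_scope.
Set Implicit Arguments. Unset Strict Implicit. Unset Printing Implicit Defensive.

(** Write m for the irrelevant ideal and I for the ideal generated by a.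

    (a) <-> (c) holds for every finitely generated ideal: mapping [x, y] to
    x v(y), where v(y) are coordinates of y on the generators, identifies
    delta(I) with the quotient of Z_1 /\ I A^n by B_1.

    (b) -> (a) is clear since I is contained in its saturation.  For
    (a) -> (b), a syzygy with entries in TF(I) is multiplied into B_1 by some
    power of m, so it suffices that A^n / B_1 has no m-torsion.  As I has grade
    n - 1, the Koszul complex of a is exact in degrees >= 2, so it gives a free
    resolution of A^n / B_1 of length n - 1.  For a regular sequence
    t_1, ..., t_n in m, killing t_1 shifts this exactness by one degree and
    turns an element of A^n / B_1 killed by all t_i into an element killed by
    t_2, ..., t_n in the next cokernel over A / (t_1); after n - 1 such steps
    one is left with an element of the free module K_n over
    A / (t_1, ..., t_(n-1)) killed by t_n, which is zero. *)

(** * Spans, finitely generated ideals and powers of ideals *)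

Section Ideals.
Variable R : comNzRingType.
Implicit Types (S J : R -> Prop) (x y : R).

Lemma ideal0 J : is_ideal J -> J 0. Proof. by case. Qed.

Lemma idealD J x y : is_ideal J -> J x -> J y -> J (x + y).
Proof. by case=> _ [h _]; apply: h. Qed.

Lemma idealMl J r x : is_ideal J -> J x -> J (r * x).
Proof. by case=> _ [_ h]; apply: h. Qed.

Lemma ideal_sum J n (f : 'I_n -> R) :
  is_ideal J -> (forall i, J (f i)) -> J (\sum_i f i).
Proof.
move=> hJ hf; apply: (big_ind J) => // [|x y]; first exact: ideal0.
exact: idealD.
Qed.

Lemma span_sub S x : S x -> span S x.
Proof.
by move=> Sx; exists 1%N, (fun=> 1), (fun=> x); rewrite big_ord1 mul1r.
Qed.

Lemma span_ideal S : is_ideal (span S).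
Proof.
split; first by exists 0%N, (fun=> 0), (fun=> 0); rewrite big_ord0; split=> // -[].
split=> [_ _ [k [c [u [Su ->]]]] [l [e [v [Sv ->]]]]|r _ [k [c [u [Su ->]]]]].
  pose glue (f : 'I_k -> R) (g : 'I_l -> R) i :=
    match split i with inl i => f i | inr i => g i end.
  exists (k + l)%N, (glue c e), (glue u v); split.
    by rewrite /glue => i; case: (split i).
  rewrite big_split_ord /glue /=; congr (_ + _); apply: eq_bigr => i _.
    by rewrite (unsplitK (inl i)).
  by rewrite (unsplitK (inr i)).
exists k, (fun i => r * c i), u; split=> //.
by rewrite mulr_sumr; apply: eq_bigr => i _; rewrite mulrA.
Qed.

Lemma span_min S J : is_ideal J -> (forall x, S x -> J x) ->
  forall x, span S x -> J x.
Proof.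
move=> hJ SJ _ [k [c [y [Sy ->]]]]; apply: ideal_sum => // i.
by apply: idealMl => //; apply: SJ.
Qed.

(** Splitting off the coefficient of the last generator is what allows a passage from A / (t_1, ...,
    t_j) to A / (t_1, ..., t_(j+1)) without forming quotient rings. *)
Lemma span_rcons (s : seq R) t x :
  span (fun z => z \in rcons s t) x ->
  exists c, span (fun z => z \in s) (x - c * t).
Proof.
have hs := span_ideal (fun z => z \in s).
apply: (span_min (J := fun x => exists c, span _ (x - c * t))) => [|y].
  split; first by exists 0; rewrite mul0r subr0; apply: ideal0.
  split=> [y z [c hc] [e he]|r y [c hc]].
    exists (c + e).
    by have -> : y + z - (c + e) * t = y - c * t + (z - e * t); [ring|apply: idealD].
  exists (r * c).
  by have -> : r * y - r * c * t = r * (y - c * t); [ring|apply: idealMl].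
rewrite mem_rcons inE => /orP[/eqP->|ys].
  by exists 1; rewrite mul1r subrr; apply: ideal0.
by exists 0; rewrite mul0r subr0; apply: span_sub.
Qed.

Lemma span_nil x : span (fun z => z \in [::]) x -> x = 0.
Proof.
apply: (span_min (J := fun x => x = 0)) => //; split=> //; split.
  by move=> y z -> ->; rewrite addr0.
by move=> r y ->; rewrite mulr0.
Qed.

Lemma ideal_ofP n (a : 'I_n -> R) x :
  ideal_of a x <-> exists c : 'I_n -> R, x = \sum_i c i * a i.
Proof.
split=> [|[c ->]].
  apply: (span_min (J := fun x => exists c, x = \sum_i c i * a i)) => [|_ [i ->]].
    split; first by exists (fun=> 0); rewrite big1 // => i _; rewrite mul0r.
    split=> [y z [c ->] [e ->]|r y [c ->]].
      exists (fun i => c i + e i); rewrite -big_split /=.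
      by apply: eq_bigr => i _; rewrite mulrDl.
    exists (fun i => r * c i); rewrite mulr_sumr.
    by apply: eq_bigr => i _; rewrite mulrA.
  exists (fun j => (j == i)%:R); rewrite (bigD1 i) //= eqxx mul1r big1 ?addr0 //.
  by move=> j /negbTE->; rewrite mul0r.
apply: (ideal_sum (span_ideal _)) => i; apply: (idealMl _ (span_ideal _)).
by apply: span_sub; exists i.
Qed.

Lemma ideal_pow_ideal (m : R -> Prop) k : is_ideal (ideal_pow m k).
Proof. by case: k => [|k] //; apply: span_ideal. Qed.

Lemma ideal_pow_le (m : R -> Prop) k l y :
  (k <= l)%N -> ideal_pow m l y -> ideal_pow m k y.
Proof.
move/subnK <-; elim: (l - k)%N y => // d IH y; rewrite addSn => h; apply: IH.
move: h; apply: (span_min (ideal_pow_ideal m _)) => _ [x [z [hx _ ->]]].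
by rewrite mulrC; apply: idealMl hx; apply: ideal_pow_ideal.
Qed.

Lemma ideal_powSr (m : R -> Prop) k x t :
  ideal_pow m k x -> m t -> ideal_pow m k.+1 (x * t).
Proof. by move=> hx ht; apply: span_sub; exists x, t. Qed.

Lemma ideal_pow1 (m : R -> Prop) k : m 1 -> ideal_pow m k 1.
Proof. by move=> m1; elim: k => // k IH; rewrite -[1]mulr1; apply: ideal_powSr. Qed.

End Ideals.

(** * The Koszul complex on the exterior algebra *)

Section Koszul.
Variable R : comNzRingType.
Variable b : nat -> R.
Implicit Types (J : R -> Prop).

(* The exterior algebra on e_0, ..., e_(n-1), with the pair (x, y) standing for
   x + e_(n-1) y. *)
Fixpoint ext n : lmodType R :=
  if n is n'.+1 then (ext n' * ext n')%type else R^o.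

(** Contraction with the [b i]. The sign in the second component comes from moving the contraction
    past the basis vector written in front. *)
Fixpoint kdiff n : ext n -> ext n :=
  if n is n'.+1 then fun z => (kdiff z.1 + b n' *: z.2, - kdiff z.2) else fun=> 0.

(* Exterior multiplication by \sum_i c_i e_i. *)
Fixpoint kwedge (c : nat -> R) n : ext n -> ext n :=
  if n is n'.+1 then fun z => (kwedge c z.1, c n' *: z.1 - kwedge c z.2) else fun=> 0.

(** The sum of the components of exterior degree at least p. The truncated [p.-1] is harmless, since
    the condition is void at p = 0. *)
Fixpoint degree_ge n (p : nat) : ext n -> Prop :=
  if n is n'.+1 then fun z => degree_ge p z.1 /\ degree_ge p.-1 z.2
  else fun z => (0 < p)%N -> z = 0.

(** For an ideal [J] this is the submodule J K of the Koszul complex K. Computing modulo it stands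
    for working over A / J. *)
Fixpoint coef_in J n : ext n -> Prop :=
  if n is n'.+1 then fun z => coef_in J z.1 /\ coef_in J z.2 else J.

Lemma kdiffD n (x y : ext n) : kdiff (x + y) = kdiff x + kdiff y.
Proof.
elim: n x y => [|n IH] x y /=; first by rewrite addr0.
congr pair; rewrite IH ?opprD // scalerDr addrACA //.
Qed.

Lemma kdiffZ n r (x : ext n) : kdiff (r *: x) = r *: kdiff x.
Proof.
elim: n x => [|n IH] x /=; first by rewrite scaler0.
by congr pair; rewrite IH ?scalerN // scalerDr !scalerA mulrC.
Qed.

Lemma kdiff0 n : kdiff (0 : ext n) = 0.
Proof. by rewrite -[X in kdiff X](scale0r 0) kdiffZ scale0r. Qed.

Lemma kdiffN n (x : ext n) : kdiff (- x) = - kdiff x.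
Proof. by rewrite -scaleN1r kdiffZ scaleN1r. Qed.

Lemma kdiffB n (x y : ext n) : kdiff (x - y) = kdiff x - kdiff y.
Proof. by rewrite kdiffD kdiffN. Qed.

Lemma kdiff_kdiff n (x : ext n) : kdiff (kdiff x) = 0.
Proof.
elim: n x => [|n IH] x //=.
by rewrite kdiffN kdiffD kdiffZ !IH add0r scalerN subrr !oppr0.
Qed.

(** Contraction is an antiderivation, so its anticommutator with exterior multiplication by a vector
    is the scalar obtained by contracting that vector. *)
Lemma kdiff_kwedge c n (x : ext n) :
  kdiff (kwedge c x) + kwedge c (kdiff x) = (\sum_(i < n) c i * b i) *: x.
Proof.
have wedgeD k (y z : ext k) : kwedge c (y + z) = kwedge c y + kwedge c z.
  elim: k y z => [|k IH] y z /=; first by rewrite addr0.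
  by congr pair; rewrite !IH // scalerDr opprD addrACA.
have wedgeZ k r (y : ext k) : kwedge c (r *: y) = r *: kwedge c y.
  elim: k y => [|k IH] y /=; first by rewrite scaler0.
  by congr pair; rewrite !IH // scalerDr scalerN !scalerA mulrC.
elim: n x => [|n IH] x /=; first by rewrite big_ord0 scale0r addr0.
rewrite big_ord_recr /=; congr pair; rewrite /= scalerDl -IH.
  rewrite wedgeD wedgeZ scalerBr scalerA [b n * c n]mulrC.
  rewrite -!addrA; congr (_ + _); rewrite [kwedge c _ + _]addrC !addrA.
  by rewrite addrNK addrC.
rewrite -[- kdiff x.2]scaleN1r wedgeZ scaleN1r opprK kdiffB kdiffZ.
by rewrite scalerDr scalerA opprB !addrA subrK addrAC.
Qed.

Lemma degree_geT n (x : ext n) : degree_ge 0 x.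
Proof. by elim: n x => [|n IH] x //=; split; apply: IH. Qed.

Lemma degree_ge0 n p : degree_ge p (0 : ext n).
Proof. by elim: n p => [|n IH] p //=; split; apply: IH. Qed.

Lemma degree_geD n p (x y : ext n) :
  degree_ge p x -> degree_ge p y -> degree_ge p (x + y).
Proof.
elim: n p x y => [|n IH] p x y /=; first by move=> hx hy p0; rewrite hx // hy // addr0.
by case=> [??] [??]; split; apply: IH.
Qed.

Lemma degree_geZ n p r (x : ext n) : degree_ge p x -> degree_ge p (r *: x).
Proof.
elim: n p x => [|n IH] p x /=; first by move=> hx p0; rewrite hx // scaler0.
by case=> [??]; split; apply: IH.
Qed.

Lemma degree_geN n p (x : ext n) : degree_ge p x -> degree_ge p (- x).
Proof. by rewrite -scaleN1r; apply: degree_geZ. Qed.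

Lemma degree_geB n p (x y : ext n) :
  degree_ge p x -> degree_ge p y -> degree_ge p (x - y).
Proof. by move=> hx /degree_geN; apply: degree_geD. Qed.

Lemma degree_ge_pred n p (x : ext n) : degree_ge p x -> degree_ge p.-1 x.
Proof.
elim: n p x => [|n IH] p x /=; first by move=> hx; case: p hx => [|[|p]] // hx _; apply: hx.
by case=> [??]; split; apply: IH.
Qed.

Lemma kdiff_degree n p (x : ext n) : degree_ge p x -> degree_ge p.-1 (kdiff x).
Proof.
elim: n p x => [|n IH] p x //= [h1 h2]; split; last by apply: degree_geN; apply: IH.
by apply: degree_geD; [apply: IH | apply: degree_geZ].
Qed.

Lemma kwedge_degree c n p (x : ext n) : degree_ge p x -> degree_ge p.+1 (kwedge c x).
Proof.
elim: n p x => [|n IH] p x //= [h1 h2]; split; first exact: IH.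
apply: degree_geB; first exact: degree_geZ.
(* At p = 0 the predecessor truncates: the induction hypothesis yields degree at least 1 where only
   degree at least 0 is wanted. *)
by case: p h1 h2 => [|p] h1 h2; [apply: (degree_ge_pred (p := 1))|]; apply: IH.
Qed.

Lemma degree_ge_gt n p (x : ext n) : (n < p)%N -> degree_ge p x -> x = 0.
Proof.
elim: n p x => [|n IH] [|p] x //=; first by move=> _; apply.
move=> np [/(IH p.+1 _ (ltnW np)) e1 /(IH p _ np) e2].
by rewrite [x]surjective_pairing e1 e2.
Qed.

(** * Elements with coefficients in an ideal *)

Section CoefIn.
Variable J : R -> Prop.
Hypothesis hJ : is_ideal J.

Lemma coef_in0 n : coef_in J (0 : ext n).
Proof. by elim: n => [|n IH] //=; apply: ideal0. Qed.

Lemma coef_inD n (x y : ext n) : coef_in J x -> coef_in J y -> coef_in J (x + y).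
Proof.
elim: n x y => [|n IH] x y /=; first exact: idealD.
by case=> [??] [??]; split; apply: IH.
Qed.

Lemma coef_inZ n r (x : ext n) : coef_in J x -> coef_in J (r *: x).
Proof.
elim: n x => [|n IH] x /=; first exact: idealMl.
by case=> [??]; split; apply: IH.
Qed.

Lemma coef_inN n (x : ext n) : coef_in J x -> coef_in J (- x).
Proof. by rewrite -scaleN1r; apply: coef_inZ. Qed.

Lemma coef_inB n (x y : ext n) : coef_in J x -> coef_in J y -> coef_in J (x - y).
Proof. by move=> hx /coef_inN; apply: coef_inD. Qed.

Lemma kdiff_coef n (x : ext n) : coef_in J x -> coef_in J (kdiff x).
Proof.
elim: n x => [|n IH] x /=; first by move=> _; apply: ideal0.
case=> [h1 h2]; split; last by apply: coef_inN; apply: IH.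
by apply: coef_inD; [apply: IH | apply: coef_inZ].
Qed.

Lemma kwedge_coef c n (x : ext n) : coef_in J x -> coef_in J (kwedge c x).
Proof.
elim: n x => [|n IH] x /=; first by move=> _; apply: ideal0.
case=> [h1 h2]; split; first exact: IH.
by apply: coef_inB; [apply: coef_inZ | apply: IH].
Qed.

Lemma coef_in_regular t n (x : ext n) :
  (forall y, J (t * y) -> J y) -> coef_in J (t *: x) -> coef_in J x.
Proof.
move=> ht; elim: n x => [|n IH] x /=; first exact: ht.
by case=> [??]; split; apply: IH.
Qed.

(** Division by t modulo [J], done coefficient by coefficient so that the quotient keeps the degree
    bound. *)
Lemma coef_in_adjoin (J' : R -> Prop) t n p (x : ext n) :
  (forall y, J' y -> exists c, J (y - c * t)) ->
  degree_ge p x -> coef_in J' x ->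
  exists w, degree_ge p w /\ coef_in J (x - t *: w).
Proof.
move=> hJ'; elim: n p x => [|n IH] p x /=.
  (* For positive p the coefficient itself is zero; the quotient must then be chosen zero to satisfy
     the degree bound. *)
  case: p => [|p] hp /hJ'[c hc]; last first.
    exists 0; split=> //; rewrite (hp isT) scaler0 subr0; exact: ideal0.
  by exists c; split=> //; rewrite /GRing.scale /= mulrC.
case=> [h1 h2] [/(IH _ _ h1)[w1 [d1 c1]] /(IH _ _ h2)[w2 [d2 c2]]].
by exists (w1, w2).
Qed.

End CoefIn.

Lemma coef_inW J J' n (x : ext n) :
  (forall y, J y -> J' y) -> coef_in J x -> coef_in J' x.
Proof.
move=> JJ'; elim: n x => [|n IH] x /=; first exact: JJ'.
by case=> [??]; split; apply: IH.
Qed.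

(* Exactness in degrees >= p, phrased with the truncations of the complex in
   degrees >= q for each q >= p so that no homogeneous components are needed. *)
Definition kexact J n p := forall q (z : ext n), (p <= q)%N ->
  degree_ge q z -> coef_in J (kdiff z) ->
  exists w, degree_ge q.+1 w /\ coef_in J (z - kdiff w).

(** * Comparing the complexes modulo J and modulo J' = J + (t), for t regular modulo J *)

Section OneStep.
Variables (J J' : R -> Prop) (t : R) (n : nat).
Hypotheses (hJ : is_ideal J) (hJ' : is_ideal J').
Hypothesis JJ' : forall y, J y -> J' y.
Hypothesis J't : J' t.
Hypothesis J'P : forall y, J' y -> exists c, J (y - c * t).
Hypothesis treg : forall y, J (t * y) -> J y.

Lemma coef_in_gen (w : ext n) : coef_in J' (t *: w).
Proof.
elim: n w => [|k IH] w /=; last by split; apply: IH.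
by rewrite /GRing.scale /= mulrC; apply: idealMl.
Qed.

(* t annihilates the Koszul homology since wedging with c is a homotopy. *)
Lemma kexact_down p : (exists c : nat -> R, t = \sum_(i < n) c i * b i) ->
  kexact J' n p.+1 -> kexact J n p.
Proof.
case=> c tE ex q z pq hz dz.
have hw : coef_in J (t *: z - kdiff (kwedge c z)).
  by rewrite tE -kdiff_kwedge addrC addKr; apply: kwedge_coef.
(* Since t z vanishes modulo [J'], the element c z is a cycle there, hence a boundary. Its
   difference from that boundary is t w modulo [J]; applying the differential gives t z = t dw, and
   t cancels. *)
have [v [hv hv']] : exists w, degree_ge q.+2 w /\ coef_in J' (kwedge c z - kdiff w).
  apply: ex => //; first exact: kwedge_degree.
  rewrite -(subKr (t *: z) (kdiff _)).
  by apply: (coef_inB hJ'); [apply: coef_in_gen | apply: coef_inW hw].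
have [w [hw1 hw2]] := coef_in_adjoin hJ J'P
  (degree_geB (kwedge_degree c hz) (kdiff_degree hv)) hv'.
exists w; split=> //; apply: (coef_in_regular treg).
have := coef_inD hJ hw (kdiff_coef hJ hw2).
by rewrite !kdiffB kdiff_kdiff kdiffZ subr0 addrA subrK -scalerBr.
Qed.

(** This is the long exact sequence of multiplication by t, by hand: if dv = t w modulo [J], then w
    is a cycle because t is regular, so w = du, and v - t u is a cycle modulo [J] in a degree where
    the complex is exact. *)
Lemma kexact_up p : kexact J n p -> kexact J' n p.+1.
Proof.
move=> ex [|q] v //; rewrite ltnS => pq hv dv.
have [w [hw1 hw2]] := coef_in_adjoin hJ J'P (kdiff_degree hv) dv.
have [|u [hu1 hu2]] := ex q w pq hw1.
  apply: (coef_in_regular treg); have := coef_inN hJ (kdiff_coef hJ hw2).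
  by rewrite kdiffB kdiff_kdiff kdiffZ sub0r opprK.
have [|||z [hz1 hz2]] := ex q.+1 (v - t *: u).
- exact: leqW.
- by apply: degree_geB => //; apply: degree_geZ.
- have := coef_inD hJ hw2 (coef_inZ hJ t hu2).
  by rewrite scalerBr addrA subrK kdiffB kdiffZ.
exists z; split=> //; rewrite -[v](subrK (t *: u)) addrAC.
by apply: coef_inD; [|apply: coef_inW hz2|apply: coef_in_gen].
Qed.

(** Given t x = dy, the element y inherits the annihilation property: if r x = dy_r, then r y - t
    y_r is a cycle, hence a boundary, so r y is a boundary modulo [J']. Once y itself is known to be
    a boundary modulo [J'], dividing dy by t exhibits x as a boundary modulo [J]. *)
Lemma ksocle_down p (T : R -> Prop) : kexact J n p.+1 -> T t ->
  (forall y : ext n, degree_ge p.+1 y ->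
     (forall r, T r -> exists w, degree_ge p.+2 w /\ coef_in J' (r *: y - kdiff w)) ->
     exists w, degree_ge p.+2 w /\ coef_in J' (y - kdiff w)) ->
  forall y : ext n, degree_ge p y ->
     (forall r, T r -> exists w, degree_ge p.+1 w /\ coef_in J (r *: y - kdiff w)) ->
     exists w, degree_ge p.+1 w /\ coef_in J (y - kdiff w).
Proof.
move=> ex Tt IH x hx hT; have [y [hy1 hy2]] := hT t Tt.
have [r Tr|z [hz1 hz2]] := IH y hy1.
  have [yr [hr1 hr2]] := hT r Tr.
  have [|||z [hz1 hz2]] := ex p.+1 (r *: y - t *: yr).
  - by [].
  - by apply: degree_geB; apply: degree_geZ.
  - have := coef_inB hJ (coef_inZ hJ t hr2) (coef_inZ hJ r hy2).
    by rewrite !scalerBr !scalerA [t * r]mulrC opprB addrC addrA subrK kdiffB !kdiffZ.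
  exists z; split=> //; rewrite -[r *: y](subrK (t *: yr)) addrAC.
  by apply: coef_inD; [|apply: coef_inW hz2|apply: coef_in_gen].
have [w [hw1 hw2]] := coef_in_adjoin hJ J'P (degree_geB hy1 (kdiff_degree hz1)) hz2.
exists w; split=> //; apply: (coef_in_regular treg).
have := coef_inD hJ hy2 (kdiff_coef hJ hw2).
by rewrite !kdiffB kdiff_kdiff kdiffZ subr0 addrA subrK -scalerBr.
Qed.

End OneStep.

(** * Induction along a regular sequence *)

Section RegularSequence.
Variables (s : seq R) (n : nat).
Hypothesis sreg : regular_seq s.
Let J j := span (fun z => z \in take j s).

Let JI j : is_ideal (J j). Proof. exact: span_ideal. Qed.

Let takeS j : (j < size s)%N -> take j.+1 s = rcons (take j s) (nth 0 s j).
Proof. exact: take_nth. Qed.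

Let JS j : (j < size s)%N -> forall y, J j y -> J j.+1 y.
Proof.
move=> js; apply: span_min => // y ys; apply: span_sub.
by rewrite takeS // mem_rcons inE ys orbT.
Qed.

Let Jnth j : (j < size s)%N -> J j.+1 (nth 0 s j).
Proof. by move=> js; apply: span_sub; rewrite takeS // mem_rcons mem_head. Qed.

Let JSP j : (j < size s)%N -> forall y, J j.+1 y -> exists c, J j (y - c * nth 0 s j).
Proof. by move=> js y; rewrite /J takeS //; apply: span_rcons. Qed.

Let Jreg j : (j < size s)%N -> forall y, J j (nth 0 s j * y) -> J j y.
Proof. by case: sreg => _ h js; apply: h. Qed.

Let coef_J0 k (x : ext k) : coef_in (J 0) x -> x = 0.
Proof.
elim: k x => [|k IH] x /=; first by rewrite /J take0; apply: span_nil.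
by case: x => x y /= [/IH-> /IH->].
Qed.

(** Depth sensitivity of the Koszul complex. Modulo the whole sequence, exactness above degree n is
    trivial because the complex vanishes there; each element of the sequence removed from the ideal
    extends exactness by one degree downwards. *)
Lemma kexact_regular p :
  (forall t, t \in s -> exists c : nat -> R, t = \sum_(i < n) c i * b i) ->
  (n < p + size s)%N -> kexact (J 0) n p.
Proof.
move=> sI.
suff ex d : (d <= size s)%N -> forall q, (n < q + d)%N -> kexact (J (size s - d)) n q.
  by move/(ex _ (leqnn _)); rewrite subnn.
elim: d => [_|d IH ds] {}p np.
  move=> q z pq hz _; exists 0; split; first exact: degree_ge0.
  have -> : z = 0.
    by apply: degree_ge_gt hz; apply: leq_trans np _; rewrite addn0.
  rewrite kdiff0 subr0; exact: coef_in0.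
have js : (size s - d.+1 < size s)%N by rewrite subnSK // leq_subr.
have jS : (size s - d.+1).+1 = (size s - d)%N by rewrite subnSK.
apply: (kexact_down (JI _) (JI _) (JS js) (Jnth js) (JSP js) (Jreg js)).
  by apply: sI; apply: mem_nth.
by rewrite jS; apply: IH; [apply: ltnW | rewrite addSnnS].
Qed.

Lemma ksocle_regular (x : ext n) :
  (0 < n)%N -> size s = n -> kexact (J 0) n 2 -> degree_ge 1 x ->
  (forall t, t \in s -> exists w, degree_ge 2 w /\ kdiff w = t *: x) ->
  exists w, degree_ge 2 w /\ kdiff w = x.
Proof.
move=> n0 sn ex0 hx xT.
(* Each further element of the sequence costs one degree of exactness, starting from degree 2 over
   the ring itself. *)
have ex j : (j < n)%N -> kexact (J j) n j.+2.
  elim: j => // j IH js; have js' : (j < size s)%N by rewrite sn ltnW.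
  apply: (kexact_up (JI _) (JI _) (JS js') (Jnth js') (JSP js') (Jreg js')).
  by apply: IH; apply: ltnW.
(* The induction descends from the top degree: d is the codegree, and degree n - d is treated modulo
   the first n - d - 1 elements of [s]. *)
have soc d : (d < n)%N -> forall y : ext n, degree_ge (n - d) y ->
    (forall t, t \in s -> exists w, degree_ge (n - d).+1 w /\
       coef_in (J (n - d.+1)) (t *: y - kdiff w)) ->
    exists w, degree_ge (n - d).+1 w /\ coef_in (J (n - d.+1)) (y - kdiff w).
  elim: d => [_ y hy yT|d IH dn].
    (* In top degree the witness w has degree above n and so vanishes; the last element of [s],
       regular modulo the others, therefore multiplies y to zero and can be cancelled. *)
    have ns : (n - 1 < size s)%N by rewrite sn subn1 prednK.
    have [w []] := yT _ (mem_nth 0 ns); rewrite subn0 in hy * => hw.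
    exists w; split=> //; move: b0; rewrite (degree_ge_gt _ hw) //.
    by rewrite kdiff0 !subr0; apply: coef_in_regular; apply: Jreg.
  have js : (n - d.+2 < size s)%N by rewrite sn subnSK // leq_subr.
  have jS : (n - d.+2).+1 = (n - d.+1)%N by rewrite subnSK.
  have dS : (n - d.+1).+1 = (n - d)%N by rewrite subnSK // ltnW.
  have := ksocle_down (JI _) (JI _) (JS js) (Jnth js) (JSP js) (Jreg js)
    (p := (n - d.+1)%N) (T := fun t => t \in s).
  rewrite jS dS; apply; last 1 first.
  - by apply: IH; apply: ltnW.
  - by rewrite -dS -jS; apply: ex; rewrite subnSK // leq_subr.
  - exact: mem_nth.
(* The required case is d = n - 1: degree 1, modulo the zero ideal [J 0]. *)
have n1 : (n - n.-1 = 1)%N by rewrite -subn1 subKn.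
have := soc n.-1; rewrite prednK // n1 subnn; case/(_ (leqnn _) x hx).
  move=> t /xT[w [hw wE]]; exists w; split=> //.
  by rewrite wE subrr; apply: coef_in0.
move=> w [hw /coef_J0 /eqP]; rewrite subr_eq0 => /eqP xE.
by exists w.
Qed.

End RegularSequence.

(** * Components of degree 0 and 1, and Koszul syzygies as boundaries *)

Fixpoint ext_const n : ext n -> R :=
  if n is n'.+1 then fun z => ext_const z.1 else id.

Fixpoint ext_lin n : ext n -> nat -> R :=
  if n is n'.+1 then
    fun z k => if k == n' then ext_const z.2 else ext_lin z.1 k
  else fun _ _ => 0.

Fixpoint of_const n (c : R) : ext n :=
  if n is n'.+1 then (of_const n' c, 0) else c.

Fixpoint of_lin n (u : nat -> R) : ext n :=
  if n is n'.+1 then (of_lin n' u, of_const n' (u n')) else 0.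


Lemma of_constZ n r c : of_const n (r * c) = r *: of_const n c.
Proof.
by elim: n => [|n IH] //=; rewrite IH; congr pair; rewrite scaler0.
Qed.

Lemma of_constD n c e : of_const n (c + e) = of_const n c + of_const n e.
Proof.
by elim: n => [|n IH] //=; rewrite IH; congr pair; rewrite addr0.
Qed.

Lemma of_linZ n r u : of_lin n (fun k => r * u k) = r *: of_lin n u.
Proof.
elim: n => [|n IH] /=; first by rewrite scaler0.
by rewrite IH of_constZ.
Qed.

Lemma of_linD n u v : of_lin n (fun k => u k + v k) = of_lin n u + of_lin n v.
Proof.
elim: n => [|n IH] /=; first by rewrite addr0.
by rewrite IH of_constD.
Qed.

Lemma eq_of_lin n u v : (forall k, (k < n)%N -> u k = v k) -> of_lin n u = of_lin n v.
Proof.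
elim: n => [|n IH] //= uv; rewrite IH ?uv // => k kn.
by apply: uv; apply: ltnW.
Qed.

Lemma of_lin_degree n u : degree_ge 1 (of_lin n u).
Proof.
elim: n => [|n IH] //=; split=> //; apply: degree_geT.
Qed.

Lemma kdiff_of_const n c : kdiff (of_const n c) = 0.
Proof.
by elim: n => [|n IH] //=; rewrite IH kdiff0 oppr0 scaler0 addr0.
Qed.

Lemma kdiff_of_lin n u : kdiff (of_lin n u) = of_const n (\sum_(i < n) u i * b i).
Proof.
elim: n => [|n IH] /=; first by rewrite big_ord0.
rewrite kdiff_of_const oppr0 IH big_ord_recr /= of_constD.
by congr (_ + _, _); rewrite mulrC of_constZ.
Qed.

Lemma ext_constD n (x y : ext n) : ext_const (x + y) = ext_const x + ext_const y.
Proof. by elim: n x y => //= n IH x y; rewrite IH. Qed.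

Lemma ext_constZ n r (x : ext n) : ext_const (r *: x) = r * ext_const x.
Proof. by elim: n x => //= n IH x; rewrite IH. Qed.

Lemma ext_linD n (x y : ext n) k : ext_lin (x + y) k = ext_lin x k + ext_lin y k.
Proof.
elim: n x y => [|n IH] x y /=; first by rewrite addr0.
by rewrite IH ext_constD; case: eqP.
Qed.

Lemma ext_linZ n r (x : ext n) k : ext_lin (r *: x) k = r * ext_lin x k.
Proof.
elim: n x => [|n IH] x /=; first by rewrite mulr0.
by rewrite IH ext_constZ; case: eqP.
Qed.

Lemma ext_const_kdiff n (x : ext n) :
  ext_const (kdiff x) = \sum_(i < n) ext_lin x i * b i.
Proof.
elim: n x => [|n IH] x /=; first by rewrite big_ord0.
rewrite ext_constD ext_constZ IH big_ord_recr /= eqxx [b n * _]mulrC.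
by congr (_ + _); apply: eq_bigr => i _; rewrite (ltn_eqF (ltn_ord i)).
Qed.

Lemma ext_of_const n c : ext_const (of_const n c) = c.
Proof. by elim: n. Qed.

Lemma ext_of_lin n u k : (k < n)%N -> ext_lin (of_lin n u) k = u k.
Proof.
elim: n => //= n IH; rewrite ltnS leq_eqVlt ext_of_const.
by case: eqP => [->|_ /IH].
Qed.

(** The shape of [B1] with indices in [nat], so that n can vary in inductions while c stays
    fixed. *)
Definition koszul_syz n (c : nat -> nat -> R) k :=
  \sum_(j < n) c k j * b j - \sum_(i < n) c i k * b i.

(** Only c k j - c j k enters the syzygy. Enlarging n by one adds the last row and column, accounted
    for by the exterior product of the new basis vector with the linear form of coefficients [u]. *)
Lemma koszul_syz_kdiff n (c : nat -> nat -> R) :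
  exists z : ext n, degree_ge 2 z /\ kdiff z = of_lin n (koszul_syz n c).
Proof.
elim: n => [|n [z [hz zE]]]; first by exists 0.
pose u k := c k n - c n k.
exists (z, of_lin n u); split; first by split=> //; apply: of_lin_degree.
rewrite /= zE kdiff_of_lin; congr pair.
  rewrite -of_linZ -of_linD; apply: eq_of_lin => k _.
  rewrite /koszul_syz !big_ord_recr /= /u; ring.
rewrite -scaleN1r -of_constZ; congr of_const.
rewrite /koszul_syz !big_ord_recr /= opprD addrACA subrr addr0 mulN1r -sumrN -sumrB.
by apply: eq_bigr => i _; rewrite /u; ring.
Qed.

Lemma kdiff_koszul_syz n (z : ext n) : degree_ge 2 z ->
  exists c, forall k, (k < n)%N -> ext_lin (kdiff z) k = koszul_syz n c k.
Proof.
elim: n z => [|n IH] z; first by exists (fun _ _ => 0).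
(* The matrix found for [z.1] is bordered by the linear coefficients of [z.2] as last column and by
   a zero last row. *)
case=> /IH[c hc] _; exists (fun k j =>
  if (k < n)%N && (j < n)%N then c k j
  else if (k < n)%N && (j == n) then ext_lin z.2 k else 0) => k.
rewrite ltnS leq_eqVlt /koszul_syz !big_ord_recr /= ltnn eqxx !andbF !andbT /= mul0r.
case: eqP => [->|_ /= kn].
  rewrite ltnn /= -scaleN1r ext_constZ ext_const_kdiff mulN1r.
  rewrite -mulr_sumr !mul0r !add0r addr0 => _; congr (- _); apply: eq_bigr => i _.
  by rewrite ltn_ord andbF.
rewrite kn ext_linD ext_linZ hc // /koszul_syz /= addr0 [RHS]addrAC [b n * _]mulrC.
by congr (_ - _ + _); apply: eq_bigr => i _; rewrite ltn_ord.
Qed.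

End Koszul.

(** * Koszul syzygies and torsion in A^n / B_1 *)

Section Torsion.
Variables (R : comNzRingType) (n : nat) (a : 'I_n -> R).
Implicit Types x : 'I_n -> R.

Lemma B1_Z1 x : B1 a x -> Z1 a x.
Proof.
case=> c xE; rewrite /Z1; under eq_bigr do rewrite xE mulrBl !mulr_suml.
rewrite sumrB [X in _ - X]exchange_big /= -sumrB big1 // => i _.
by rewrite -sumrB big1 // => j _; ring.
Qed.

Lemma B1_ext x y : x =1 y -> B1 a x -> B1 a y.
Proof. by move=> xy [c cE]; exists c => k; rewrite -xy. Qed.

Lemma B1_0 : B1 a (fun=> 0).
Proof. by exists (fun _ _ => 0) => k; rewrite subrr. Qed.

Lemma B1_D x y : B1 a x -> B1 a y -> B1 a (fun k => x k + y k).
Proof.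
case=> [c xE] [e yE]; exists (fun i j => c i j + e i j) => k; rewrite xE yE.
by rewrite -!sumrB -big_split /=; apply: eq_bigr => i _; ring.
Qed.

Lemma B1_scale r x : B1 a x -> B1 a (fun k => r * x k).
Proof.
case=> [c xE]; exists (fun i j => r * c i j) => k; rewrite xE.
by rewrite -!sumrB mulr_sumr /=; apply: eq_bigr => i _; ring.
Qed.

Lemma B1_sum l (x : 'I_l -> 'I_n -> R) :
  (forall i, B1 a (x i)) -> B1 a (fun k => \sum_i x i k).
Proof.
elim: l x => [|l IH] x hx.
  by apply: B1_ext B1_0 => k; rewrite big_ord0.
apply: B1_ext (B1_D (IH _ (fun i => hx (widen_ord (leqnSn l) i))) (hx ord_max)).
by move=> k; rewrite big_ord_recr.
Qed.

(** The ideal kills the first Koszul homology: for r = sum u_j a_j, the matrix x_k u_j gives r x_k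
    minus u_k times the vanishing sum of the x_i a_i. *)
Lemma B1_ideal_Z1 r x : ideal_of a r -> Z1 a x -> B1 a (fun k => r * x k).
Proof.
case/ideal_ofP=> u -> xZ; exists (fun k j => x k * u j) => k.
rewrite [X in _ - X](_ : _ = u k * \sum_i x i * a i); last first.
  by rewrite mulr_sumr; apply: eq_bigr => i _; ring.
by rewrite xZ mulr0 subr0 mulr_suml; apply: eq_bigr => i _; ring.
Qed.

Lemma B1_ideal x : B1 a x -> ext_mod (ideal_of a) x.
Proof.
case=> c xE k; apply/ideal_ofP.
exists (fun j => c k j - c j k); rewrite xE -sumrB.
by apply: eq_bigr => j _; rewrite mulrBl.
Qed.

Lemma Z1_scale y x : Z1 a x -> Z1 a (fun k => y * x k).
Proof.
by rewrite /Z1 => xE; under eq_bigr do rewrite -mulrA; rewrite -mulr_sumr xE mulr0.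
Qed.

(* The cokernel of the Koszul differential K_2 -> K_1 has projective dimension
   at most n - 1, hence positive depth with respect to a regular sequence of
   length n. *)
Lemma B1_socle (s : seq R) x :
  (0 < n)%N -> regular_seq s -> size s = n ->
  (exists s', [/\ size s' = n.-1, forall y, y \in s' -> ideal_of a y & regular_seq s']) ->
  (forall t, t \in s -> B1 a (fun k => t * x k)) -> B1 a x.
Proof.
move=> n0 sreg sn [s' [sn' s'I s'reg]] xT.
(* Extension of finite families to [nat] by a default value, as the Koszul complex is built on
   sequences. *)
pose ex (T : Type) (x0 : T) (f : 'I_n -> T) k := if insub k is Some i then f i else x0.
have exE T (x0 : T) f (i : 'I_n) : ex T x0 f i = f i by rewrite /ex valK.
pose b := ex R 0 a.
(* The n - 1 regular elements of the ideal give exactness from degree 2 on, because n < 2 + (n -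
   1). *)
have ex2 : kexact b (span (fun z => z \in take 0 s)) n 2.
  rewrite take0 -(take0 s'); apply: kexact_regular => // [t /s'I/ideal_ofP[c ->]|].
    by exists (ex R 0 c); apply: eq_bigr => i _; rewrite /b !exE.
  by rewrite sn' add2n prednK.
have [t ts|w [hw wE]] := ksocle_regular sreg n0 sn ex2 (of_lin_degree n (ex R 0 x)).
  have [c cE] := xT t ts.
  pose c' := ex (nat -> R) (fun=> 0) (fun i => ex R 0 (c i)).
  have [z [hz zE]] := koszul_syz_kdiff b n c'.
  exists z; split=> //; rewrite zE -of_linZ; apply: eq_of_lin => k kn.
  rewrite -[k]/(val (Ordinal kn)) exE cE /koszul_syz /c' exE.
  by congr (_ - _); apply: eq_bigr => i _; rewrite /b !exE.
have [c cE] := kdiff_koszul_syz b hw.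
exists (fun i j => c i j) => k.
rewrite -(exE R 0 x) -(ext_of_lin (ex R 0 x) (ltn_ord k)) -wE cE ?ltn_ord //.
by congr (_ - _); apply: eq_bigr => i _; rewrite /b exE.
Qed.

(** Induction on the exponent: for y in the k-th power of m, every t in the regular sequence sends y
    x into [B1], so the socle statement removes one factor of m. *)
Lemma B1_saturated (m : R -> Prop) x : (0 < n)%N ->
  (exists s, [/\ size s = n, forall y, y \in s -> m y & regular_seq s]) ->
  (exists s', [/\ size s' = n.-1, forall y, y \in s' -> ideal_of a y & regular_seq s']) ->
  forall k, (forall y, ideal_pow m k y -> B1 a (fun i => y * x i)) -> B1 a x.
Proof.
move=> n0 [s [sn sm sreg]] hs'; elim=> [|k IH] xB.
  by have [c cE] := xB 1 I; exists c => i; rewrite -cE mul1r.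
apply: IH => y hy; apply: (B1_socle n0 sreg sn hs') => t ts.
have [c cE] := xB _ (ideal_powSr hy (sm t ts)).
by exists c => i; rewrite -cE mulrCA mulrA.
Qed.

(** There are finitely many coordinates, so the maximum of their exponents serves for all. *)
Lemma TF_uniform (m : R -> Prop) J x : ext_mod (TF m J) x ->
  exists k, forall i y, ideal_pow m k y -> J (x i * y).
Proof.
move=> xTF.
suff [k hk] : exists k, forall i, i \in enum 'I_n -> forall y, ideal_pow m k y -> J (x i * y).
  by exists k => i; apply: hk; rewrite mem_enum.
elim: (enum _) => [|i e [k hk]]; first by exists 0%N.
have [l hl] := xTF i; exists (maxn k l) => j; rewrite inE => /orP[/eqP->|je] y hy.
  by apply: hl; apply: ideal_pow_le hy; apply: leq_maxr.
by apply: hk => //; apply: ideal_pow_le hy; apply: leq_maxl.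
Qed.

Lemma TF_sub (m : R -> Prop) (r : R) : ideal_of a r -> TF m (ideal_of a) r.
Proof.
by move=> rI; exists 0%N => y _; rewrite mulrC; apply: (idealMl _ (span_ideal _)).
Qed.

End Torsion.

(** * The symmetric square and the equivalence of (a) and (c) *)

Section Syzygetic.
Variables (R : comNzRingType) (n : nat) (a : 'I_n -> R).
Local Notation I := (ideal_of a).

(** The relation submodule inside the coefficient functions on symbols. Congruence modulo it,
    [sym2_eq], is equality in the symmetric square, so no quotient has to be built. *)
Definition sym2_rel (f : R * R -> R) :=
  exists (l : nat) (c : 'I_l -> R) (g : 'I_l -> sym2_gen R),
    (forall j, sym2_gen_in I (g j)) /\
    forall p, f p = \sum_(j < l) c j * sym2_gen_coef (g j) p.

Definition symb x y (p : R * R) : R := ind R ((x, y) == p).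

Definition sym2_eq (f g : R * R -> R) := sym2_rel (fun p => f p - g p).

Lemma sym2_rel_ext f g : f =1 g -> sym2_rel f -> sym2_rel g.
Proof. by move=> fg [l [c [h [hi hE]]]]; exists l, c, h; split=> // p; rewrite -fg. Qed.

Lemma sym2_rel0 : sym2_rel (fun=> 0).
Proof.
exists 0%N, (fun=> 0), (fun=> S2Sym 0 0); split=> [[]|p] //.
by rewrite big_ord0.
Qed.

Lemma sym2_relD f g : sym2_rel f -> sym2_rel g -> sym2_rel (fun p => f p + g p).
Proof.
case=> [k [c [u [Su fE]]]] [l [e [v [Sv gE]]]].
pose glue (T : Type) (f : 'I_k -> T) (g : 'I_l -> T) i :=
  match split i with inl i => f i | inr i => g i end.
exists (k + l)%N, (glue R c e), (glue _ u v); split.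
  by rewrite /glue => i; case: (split i).
move=> p; rewrite fE gE big_split_ord /glue /=; congr (_ + _); apply: eq_bigr => i _.
  by rewrite (unsplitK (inl i)).
by rewrite (unsplitK (inr i)).
Qed.

Lemma sym2_relZ r f : sym2_rel f -> sym2_rel (fun p => r * f p).
Proof.
case=> [k [c [u [Su fE]]]]; exists k, (fun i => r * c i), u; split=> // p.
by rewrite fE mulr_sumr; apply: eq_bigr => i _; rewrite mulrA.
Qed.

Lemma sym2_rel_gen g : sym2_gen_in I g -> sym2_rel (sym2_gen_coef g).
Proof.
move=> hg; exists 1%N, (fun=> 1), (fun=> g); split=> // p.
by rewrite big_ord1 mul1r.
Qed.

Lemma sym2_eq_refl f g : f =1 g -> sym2_eq f g.
Proof. by move=> fg; apply: sym2_rel_ext sym2_rel0 => p; rewrite fg subrr. Qed.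

Lemma sym2_eq_trans g f h : sym2_eq f g -> sym2_eq g h -> sym2_eq f h.
Proof.
by move=> fg gh; apply: sym2_rel_ext (sym2_relD fg gh) => p; rewrite addrA subrK.
Qed.

Lemma sym2_eq_sym f g : sym2_eq f g -> sym2_eq g f.
Proof. by move=> fg; apply: sym2_rel_ext (sym2_relZ (-1) fg) => p; ring. Qed.

Lemma sym2_eqD f g f' g' : sym2_eq f g -> sym2_eq f' g' ->
  sym2_eq (fun p => f p + f' p) (fun p => g p + g' p).
Proof. by move=> h h'; apply: sym2_rel_ext (sym2_relD h h') => p; ring. Qed.

Lemma sym2_eqZ r f g : sym2_eq f g -> sym2_eq (fun p => r * f p) (fun p => r * g p).
Proof. by move=> h; apply: sym2_rel_ext (sym2_relZ r h) => p; ring. Qed.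

Lemma sym2_eq_sum k (F F' : 'I_k -> R * R -> R) :
  (forall i, sym2_eq (F i) (F' i)) ->
  sym2_eq (fun p => \sum_i F i p) (fun p => \sum_i F' i p).
Proof.
elim: k F F' => [|k IH] F F' h.
  by apply: sym2_eq_refl => p; rewrite !big_ord0.
apply: sym2_rel_ext (sym2_eqD (IH _ _ (fun i => h (widen_ord (leqnSn k) i))) (h ord_max)).
by move=> p; rewrite !big_ord_recr.
Qed.

Lemma symbC x y : I x -> I y -> sym2_eq (symb x y) (symb y x).
Proof. by move=> hx hy; apply: (sym2_rel_gen (g := S2Sym x y)). Qed.

Lemma symbDl x x' y : I x -> I x' -> I y ->
  sym2_eq (symb (x + x') y) (fun p => symb x y p + symb x' y p).
Proof.
move=> hx hx' hy; apply: (sym2_rel_ext _ (sym2_rel_gen (g := S2Add x x' y) _)) => // p.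
by rewrite /= opprD addrA.
Qed.

Lemma symbZl r x y : I x -> I y -> sym2_eq (symb (r * x) y) (fun p => r * symb x y p).
Proof. by move=> hx hy; apply: (sym2_rel_gen (g := S2Scal r x y)). Qed.

Lemma symb_suml k (c x : 'I_k -> R) y : (forall i, I (x i)) -> I y ->
  sym2_eq (symb (\sum_i c i * x i) y) (fun p => \sum_i c i * symb (x i) y p).
Proof.
move=> hx hy; have hI := span_ideal (fun y => exists i, y = a i).
elim: k c x hx => [|k IH] c x hx.
  (* The symbol [0, y] vanishes by the scalar relation with r = 0. *)
  rewrite big_ord0; have := symbZl 0 (ideal0 hI) hy; rewrite mul0r.
  by move/sym2_eq_trans; apply; apply: sym2_eq_refl => p; rewrite big_ord0 mul0r.
rewrite big_ord_recr /=; apply: sym2_eq_trans.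
  apply: symbDl => //; last exact: idealMl.
  by apply: ideal_sum => // i; apply: idealMl.
apply: sym2_eq_trans.
  apply: sym2_eqD; first exact: IH.
  exact: symbZl.
by apply: sym2_eq_refl => p; rewrite big_ord_recr.
Qed.

Lemma gen_ideal i : I (a i). Proof. by apply: span_sub; exists i. Qed.

(** Expanding each y_i on the generators turns the formal sum into the sum of the [w_j, a_j], where
    w is a syzygy with entries in I. By hypothesis w is Koszul, and the sum then cancels by the
    symmetry of the symbols. *)
Lemma B1_syzygetic :
  (forall x, Z1 a x -> ext_mod I x -> B1 a x) -> syzygetic I.
Proof.
move=> Z1B1 k r x y xyI xy0; have hI := span_ideal (fun y => exists i, y = a i).
suff : sym2_eq (formal_coef r x y) (fun=> 0).
  by apply: sym2_rel_ext => p; rewrite subr0.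
have [u uE] : exists u : 'I_k -> 'I_n -> R, forall i, y i = \sum_j u i j * a j.
  apply: (@fin_all_exists _ (fun=> 'I_n -> R) (fun i u => y i = \sum_j u j * a j)) => i.
  by apply/ideal_ofP; case: (xyI i).
pose w j := \sum_i (r i * u i j) * x i.
have wI : ext_mod I w.
  by move=> j; apply: ideal_sum => // i; apply: idealMl => //; case: (xyI i).
have [c cE] : B1 a w.
  apply: Z1B1 => //; rewrite /Z1 -[RHS]xy0 /w; under eq_bigr do rewrite mulr_suml.
  rewrite exchange_big /=; apply: eq_bigr => i _; rewrite uE !mulr_sumr.
  by apply: eq_bigr => j _; ring.
apply: (@sym2_eq_trans (fun p => \sum_j symb (w j) (a j) p)).
  apply: (@sym2_eq_trans (fun p => \sum_i r i * \sum_j u i j * symb (x i) (a j) p)).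
    apply: sym2_eq_sum => i; apply: sym2_eqZ; case: (xyI i) => hx hy.
    apply: sym2_eq_trans; first exact: symbC.
    rewrite uE; apply: sym2_eq_trans.
      by apply: symb_suml => // j; apply: gen_ideal.
    apply: sym2_eq_sum => j; apply: sym2_eqZ; apply: symbC => //; exact: gen_ideal.
  apply: (@sym2_eq_trans (fun p => \sum_j \sum_i (r i * u i j) * symb (x i) (a j) p)).
    apply: sym2_eq_refl => p; rewrite exchange_big /=; apply: eq_bigr => i _.
    by rewrite mulr_sumr; apply: eq_bigr => j _; rewrite mulrA.
  apply: sym2_eq_sum => j; apply: sym2_eq_sym.
  by apply: symb_suml => [i|]; [case: (xyI i) | apply: gen_ideal].
apply: (@sym2_eq_trans (fun p => \sum_k \sum_j (c k j - c j k) * symb (a j) (a k) p)).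
  apply: sym2_eq_sum => j.
  have -> : w j = \sum_i (c j i - c i j) * a i.
    by rewrite cE -sumrB; apply: eq_bigr => i _; rewrite mulrBl.
  by apply: symb_suml => [i|]; apply: gen_ideal.
pose s j k := symb (a j) (a k).
(* Exchanging the two indices in one half of the sum moves the antisymmetry from the coefficients to
   the symbols. *)
apply: (@sym2_eq_trans (fun p => \sum_k \sum_j c k j * (s j k p - s k j p))).
  apply: sym2_eq_refl => p.
  under eq_bigr do under eq_bigr do rewrite mulrBl.
  under [RHS]eq_bigr do under eq_bigr do rewrite mulrBr.
  under eq_bigr do rewrite sumrB.
  under [RHS]eq_bigr do rewrite sumrB.
  by rewrite !sumrB; congr (_ - _); rewrite exchange_big.
apply: (@sym2_eq_trans (fun p => \sum_(k < n) \sum_(j < n) c k j * 0)).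
  apply: sym2_eq_sum => k'; apply: sym2_eq_sum => j; apply: sym2_eqZ.
  apply: (sym2_rel_ext _ (symbC (gen_ideal j) (gen_ideal k'))) => p.
  by rewrite subr0.
by apply: sym2_eq_refl => p; rewrite big1 // => i _; rewrite big1 // => j _; rewrite mulr0.
Qed.

(** Coordinates are a function of the element, not of its position, so repeated elements get equal
    coordinates; restricting to a finite list avoids any choice principle. *)
Lemma finite_coordinates (L : seq R) : (forall y, y \in L -> I y) ->
  exists v : R -> 'I_n -> R, forall y, y \in L -> y = \sum_j v y j * a j.
Proof.
elim: L => [|y L IH] hL; first by exists (fun _ _ => 0).
have [z zL|v hv] := IH; first by apply: hL; rewrite inE zL orbT.
have /ideal_ofP[e eE] := hL y (mem_head _ _).
exists (fun z => if z == y then e else v z) => z; rewrite inE.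
by case: eqP => [->|_ /hv].
Qed.

Definition sym2_gen_pairs (g : sym2_gen R) : seq (R * R) :=
  match g with
  | S2Add x x' y => [:: (x + x', y); (x, y); (x', y)]
  | S2Scal r x y => [:: (r * x, y); (x, y)]
  | S2Sym x y => [:: (x, y); (y, x)]
  end.

Lemma sym2_gen_pairsP g p : sym2_gen_in I g -> p \in sym2_gen_pairs g -> I p.2.
Proof.
case: g => [x x' y [_ _ hy]|r x y [_ hy]|x y [hx hy]] /=.
- by rewrite !inE => /or3P[] /eqP->.
- by rewrite !inE => /orP[] /eqP->.
- by rewrite !inE => /orP[] /eqP->.
Qed.

Lemma sum_ind (L : seq (R * R)) (F : R * R -> R) q : uniq L -> q \in L ->
  \sum_(p <- L) ind R (q == p) * F p = F q.
Proof.
move=> uL qL; rewrite (bigD1_seq q) //= eqxx /ind mul1r big1 ?addr0 // => p.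
by rewrite eq_sym => /negbTE->; rewrite mul0r.
Qed.

(* [x, y] |-> x v(y), for v(y) the coordinates of y, induces Sym^2(I) -> A^n / B_1. *)
Lemma sym2_gen_B1 (L : seq (R * R)) (v : R -> 'I_n -> R) g :
  uniq L -> (forall p, p \in L -> p.2 = \sum_j v p.2 j * a j) ->
  {subset sym2_gen_pairs g <= L} ->
  B1 a (fun k => \sum_(p <- L) sym2_gen_coef g p * (p.1 * v p.2 k)).
Proof.
move=> uL vE; case: g => [x x' y|r x y|x y] /= gL.
- apply: B1_ext (B1_0 a) => k; under eq_bigr do rewrite !mulrBl.
  by rewrite !sumrB !sum_ind ?gL ?inE ?eqxx ?orbT //=; ring.
- apply: B1_ext (B1_0 a) => k; under eq_bigr do rewrite mulrBl -mulrA.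
  by rewrite sumrB -mulr_sumr !sum_ind ?gL ?inE ?eqxx ?orbT //=; ring.
(* The other two kinds of relation map to zero. The symmetry relation maps to x v(y) - y v(x), which
   is Koszul after expanding x and y on the generators. *)
exists (fun k j => v y k * v x j) => k; under eq_bigr do rewrite mulrBl.
rewrite sumrB !sum_ind ?gL ?inE ?eqxx ?orbT //=.
have xE : x = \sum_j v x j * a j by apply: (vE (y, x)); rewrite gL // !inE eqxx orbT.
have yE : y = \sum_j v y j * a j by apply: (vE (x, y)); rewrite gL // !inE eqxx.
by congr (_ - _); [rewrite {1}xE | rewrite {1}yE];
  rewrite mulr_suml; apply: eq_bigr => i _; ring.
Qed.

(** The sum of the [x_i, a_i] maps to zero, hence is a combination of relations, and its image, the
    sum of the x_i v(a_i), lies in [B1]. Replacing v(a_i) by e_i changes it by elements of I Z_1,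
    which lie in [B1] too. *)
Lemma syzygetic_B1 x : syzygetic I -> Z1 a x -> ext_mod I x -> B1 a x.
Proof.
move=> syz xZ xI.
have [||l [c [g [gI gE]]]] := syz n (fun=> 1) x a.
- by move=> i; split=> //; apply: gen_ideal.
- by rewrite -[RHS]xZ; apply: eq_bigr => i _; rewrite mul1r.
(* All symbols occurring in the formal sum or in a relation, each listed once so that summing over
   [L] evaluates linear maps correctly. *)
pose L := undup ([seq (x i, a i) | i <- enum 'I_n] ++
  flatten [seq sym2_gen_pairs (g j) | j <- enum 'I_l]).
have uL : uniq L by apply: undup_uniq.
have xL i : (x i, a i) \in L.
  by rewrite mem_undup mem_cat (map_f (fun i => (x i, a i))) // mem_enum.
have gL j : {subset sym2_gen_pairs (g j) <= L}.
  move=> p hp; rewrite mem_undup mem_cat; apply/orP; right.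
  by apply/flatten_mapP; exists j; rewrite // mem_enum.
have [y|v vE] := @finite_coordinates [seq p.2 | p <- L].
  case/mapP=> p; rewrite mem_undup mem_cat => /orP[/mapP[i _ ->] ->|].
    exact: gen_ideal.
  by case/flatten_mapP=> j _ /(sym2_gen_pairsP (gI j)) h ->.
have {}vE p : p \in L -> p.2 = \sum_j v p.2 j * a j by move=> pL; apply: vE; apply: map_f.
have h1 : B1 a (fun k => \sum_i x i * v (a i) k).
  have := B1_sum (fun j => B1_scale (c j) (sym2_gen_B1 uL vE (gL j))).
  apply: B1_ext => k; under eq_bigr do rewrite mulr_sumr.
  rewrite exchange_big /=.
  transitivity (\sum_(p <- L) formal_coef (fun=> 1) x a p * (p.1 * v p.2 k)).
    apply: eq_bigr => p _; rewrite gE mulr_suml.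
    by apply: eq_bigr => j _; rewrite mulrA.
  rewrite /formal_coef; under [LHS]eq_bigr do rewrite mulr_suml.
  rewrite exchange_big /=; apply: eq_bigr => i _.
  by under eq_bigr do rewrite mul1r; rewrite sum_ind.
(* Both e_i and v(a_i) are coordinates of a_i, so their difference is a syzygy, and it is multiplied
   by x_i in I. *)
have h2 : B1 a (fun k => \sum_i x i * ((i == k)%:R - v (a i) k)).
  apply: B1_sum => i; apply: B1_ideal_Z1 => //; rewrite /Z1.
  under eq_bigr do rewrite mulrBl.
  rewrite sumrB -(vE _ (xL i)) /= (bigD1 i) //= eqxx mul1r big1 ?addr0 ?subrr //.
  by move=> j; rewrite eq_sym => /negbTE->; rewrite mul0r.
apply: B1_ext (B1_D h1 h2) => k; rewrite -big_split /= (bigD1 k) //= eqxx.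
rewrite big1 ?addr0; first by rewrite -mulrDr addrC subrK mulr1.
by move=> i /negbTE->; rewrite -mulrDr addrC subrK mulr0.
Qed.

End Syzygetic.

(** * The equivalence of the three conditions *)

Theorem mainTheorem11 (A : comNzRingType) (G : nat -> A -> Prop) (n : nat)
    (a : 'I_n -> A) :
  noetherian A -> is_grading G -> (0 < n)%N ->
  grade_ge (irrelevant G) n ->
  grade_ge (ideal_of a) n.-1 -> ~ grade_ge (ideal_of a) n ->
  ((forall x, B1 a x <-> Z1 a x /\ ext_mod (ideal_of a) x) <-> syzygetic (ideal_of a)) /\
  ((forall x, B1 a x <-> Z1 a x /\ ext_mod (TF (irrelevant G) (ideal_of a)) x)
     <-> syzygetic (ideal_of a)).
Proof.
move=> _ _ n0 gm gI gIn; set m := irrelevant G in gm *.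
have hs' : exists s', [/\ size s' = n.-1,
    forall y, y \in s' -> ideal_of a y & regular_seq s'].
  (* The unit ideal has infinite grade by convention, so the upper bound on the grade of I excludes
     it. *)
  by case: gI => // I1; case: gIn; left.
have sat x : syzygetic (ideal_of a) -> Z1 a x ->
    ext_mod (TF m (ideal_of a)) x -> B1 a x.
  move=> syz xZ /TF_uniform[k xk]; case: gm => [m1|hs].
    (* If m contains 1, so do all its powers, and the entries of x already lie in I. *)
    apply: syzygetic_B1 => // i; rewrite -[x i]mulr1; apply: xk.
    exact: ideal_pow1.
  apply: (B1_saturated n0 hs hs' (k := k)) => y hy.
  apply: syzygetic_B1 => //; first exact: Z1_scale.
  by move=> i; rewrite mulrC; apply: xk.
split; split=> [eqB|syz].
- by apply: B1_syzygetic => x xZ xI; apply/eqB.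
- move=> x; split=> [xB|[]]; last exact: syzygetic_B1.
  by split; [apply: B1_Z1 | apply: B1_ideal].
- apply: B1_syzygetic => x xZ xI; apply/eqB; split=> // i.
  exact: TF_sub.
- move=> x; split=> [xB|[]]; last exact: sat.
  by split=> [|i]; [apply: B1_Z1 | apply: TF_sub; apply: B1_ideal].
Qed.
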